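(* Let $(K,d)$ be a complete metric space and let $Y$ be a Banach space. Then the subset of $C_b(K,Y)$ (respectively of $C_b^u(K,Y)$) of all bounded continuous (respectively bounded uniformly continuous) functions attaining strongly their sup-norm is the complement of a $\sigma$-porous subset of the Banach space $(C_b(K,Y),\|\cdot\|_\infty)$ (respectively of $(C_b^u(K,Y),\|\cdot\|_\infty)$).
   Context: Banach spaces are real and nonzero; $K$ is nonempty. $C_b(K,Y)$ (respectively $C_b^u(K,Y)$) is the Banach space of all bounded continuous (respectively bounded uniformly continuous) functions from $K$ to $Y$, with the sup-norm $\|\cdot\|_\infty$. A function $T\in C_b(K,Y)$ attains strongly its sup-norm if there is $x_0\in K$ such that $\|T(x_0)\|=\|T\|_\infty$ and for every sequence $(x_n)\subset K$, $\|T(x_n)\|\to\|T\|_\infty$ implies $d(x_n,x_0)\to0$. $\sigma$-porosity: a subset $A$ of a metric space $M$ is porous in $M$ if there exist $\lambda_0\in(0,1]$ and $r_0>0$ such that for any $x\in M$ and $r\in(0,r_0]$ there exists $y\in M$ such that $\mathring{B}(y;\lambda_0 r)\subset\mathring{B}(x;r)\cap(M\setminus A)$, where $\mathring{B}(\cdot\,;\cdot)$ denotes open balls of $M$. $A$ is $\sigma$-porous if it is a countable union of porous sets in $M$. *)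

(* Defs.v *)
From HB Require Import structures.
From mathcomp Require Import all_boot all_order all_algebra.
From mathcomp Require Import all_classical all_reals all_analysis.
From mathcomp Require Import ring.

Set Implicit Arguments.
Unset Strict Implicit.
Unset Printing Implicit Defensive.

Import Order.TTheory GRing.Theory Num.Theory.
Import numFieldNormedType.Exports.

Local Open Scope classical_set_scope.
Local Open Scope ring_scope.

(* As [Complete] extends [isPointed], a complete metric space is nonempty. *)
#[short(type="completeMetricType")]
HB.structure Definition CompleteMetric (R : numDomainType) :=
  {T of Metric R T & Complete T}.

Section porosity.
Context {R : realType} {M : metricType R}.

Definition porous (A : set M) : Prop :=
  exists lambda0 r0 : R, [/\ 0 < lambda0, lambda0 <= 1, 0 < r0 &
    forall (x : M) (r : R), 0 < r -> r <= r0 ->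
      exists y : M, ball y (lambda0 * r) `<=` ball x r `&` ~` A].

Definition sigma_porous (A : set M) : Prop :=
  exists2 A_ : nat -> set M, (forall n, porous (A_ n)) & A = \bigcup_n A_ n.

End porosity.

Section supnorm.
Context {R : realType} {K : Type} {Y : normedModType R}.
Implicit Types f g : K -> Y.

(* [sup] is junk (0) on unbounded sets: [supnorm f] is the sup-norm only for
   bounded [f]; on an empty [K] it is 0. *)
Definition supnorm f : R := sup (range (fun x => `|f x|)).

Lemma bounded_fun_leP f :
  bounded_fun f <-> exists M : R, forall x, `|f x| <= M.
Proof.
split=> [[M [_ fM]]|[M fM]].
  by exists (M + 1) => x; apply: fM => //; rewrite ltrDl.
exists M; split; first exact: num_real.
by move=> N MN x _ /=; rewrite (le_trans (fM x))// ltW.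
Qed.

Lemma supnorm_ub f x : bounded_fun f -> `|f x| <= supnorm f.
Proof.
move=> /bounded_fun_leP[M fM]; apply: ub_le_sup; last by exists x.
by exists M => _ [z _ <-]; exact: fM.
Qed.

Lemma supnorm_le f (e : R) : 0 <= e -> (forall x, `|f x| <= e) ->
  supnorm f <= e.
Proof.
move=> e0 fe; rewrite /supnorm.
have [->|/set0P fn0] := eqVneq (range (fun x => `|f x|)) set0.
  by rewrite sup0.
by apply: ge_sup => // _ [x _ <-].
Qed.

Lemma supnorm_ge0 f : bounded_fun f -> 0 <= supnorm f.
Proof.
move=> bf; rewrite /supnorm.
have [->|/set0P[_ [x _ _]]] := eqVneq (range (fun x => `|f x|)) set0.
  by rewrite sup0.
exact: le_trans (normr_ge0 (f x)) (supnorm_ub x bf).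
Qed.

Lemma ler_supnormD f g : bounded_fun f -> bounded_fun g ->
  supnorm (f + g) <= supnorm f + supnorm g.
Proof.
move=> bf bg; apply: supnorm_le => [|x]; first by rewrite addr_ge0 ?supnorm_ge0.
by rewrite (le_trans (ler_normD _ _))// lerD ?supnorm_ub.
Qed.

Lemma bounded_funZ (a : R) f : bounded_fun f -> bounded_fun (a *: f).
Proof.
move=> /bounded_fun_leP[M fM]; apply/bounded_fun_leP; exists (`|a| * M) => x.
by rewrite normrZ ler_wpM2l// fM.
Qed.

Lemma bounded_fun_add f g : bounded_fun f -> bounded_fun g ->
  bounded_fun (f + g).
Proof.
move=> /bounded_fun_leP[M fM] /bounded_fun_leP[N gN]; apply/bounded_fun_leP; exists (M + N) => x.
by rewrite (le_trans (ler_normD _ _))// lerD ?fM ?gN.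
Qed.

Lemma supnormZ (a : R) f : bounded_fun f ->
  supnorm (a *: f) = `|a| * supnorm f.
Proof.
move=> bf; apply/eqP; rewrite eq_le; apply/andP; split.
  apply: supnorm_le => [|x]; first by rewrite mulr_ge0 ?supnorm_ge0.
  by rewrite normrZ ler_wpM2l// supnorm_ub.
have [->|a0] := eqVneq a 0.
  by rewrite normr0 mul0r; apply/supnorm_ge0/bounded_funZ.
rewrite mulrC -ler_pdivlMr ?normr_gt0//; apply: supnorm_le => [|x].
  by rewrite divr_ge0//; apply/supnorm_ge0/bounded_funZ.
rewrite ler_pdivlMr ?normr_gt0// mulrC -normrZ.
exact: (supnorm_ub x (bounded_funZ a bf)).
Qed.

Lemma supnorm0_eq0 f : bounded_fun f -> supnorm f = 0 -> f = 0.
Proof.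
move=> bf f0; apply/funext => x; apply/eqP.
by rewrite -normr_le0 -f0 supnorm_ub.
Qed.

Lemma unif_approx_bounded g :
  (forall e : R, 0 < e ->
     exists2 f, bounded_fun f & forall x, `|g x - f x| <= e) ->
  bounded_fun g.
Proof.
move=> /(_ _ ltr01)[f /bounded_fun_leP[M fM] fg]; apply/bounded_fun_leP.
exists (1 + M) => x.
by rewrite -(subrK (f x) (g x)) (le_trans (ler_normD _ _))// lerD ?fg ?fM.
Qed.

End supnorm.


Section unif_lim.
Context {R : realType} {K : Type} {Y : completeNormedModType R}.
Context {T : normedModType R} (ev : T -> K -> Y).
Hypothesis ev_le : forall f g x, `|ev f x - ev g x| <= `|f - g|.

Lemma cauchy_unif_lim (F : set_system T) : ProperFilter F -> cauchy F ->
  exists g : K -> Y, forall e : R, 0 < e ->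
    \forall f \near F, forall x, `|g x - ev f x| <= e.
Proof.
move=> FF /cauchy_ballP cF.
have cvx x : cvg (ev f x @[f --> F]).
  apply/cauchy_cvgP/cauchy_ballP => e e0.
  have [[A B] /= [FA FB] AB] := cF e e0.
  exists ((ev ^~ x) @` A, (ev ^~ x) @` B) => /=.
    by split; [apply: filterS FA => a Aa|apply: filterS FB => b Bb];
      [exists a|exists b].
  move=> [_ _] /= [[a Aa <-] [b Bb <-]].
  have := AB (a, b) (conj Aa Bb); rewrite /= -!ball_normE /=.
  exact: le_lt_trans.
exists (fun x => lim (ev f x @[f --> F])) => e e0.
have [[A B] /= [FA FB] AB] := cF e e0.
apply: filterS FB => f Bf x.
apply/ler_addgt0Pl => d d0.
near F => a.
rewrite -(subrK (ev a x) (lim _)) -addrA (le_trans (ler_normD _ _))// lerD//.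
  near: a; have /cvgrPdist_le := cvx x; exact.
have Aa : A a by near: a.
rewrite (le_trans (ev_le _ _ _))// ltW//.
by have := AB (a, f) (conj Aa Bf); rewrite /= -ball_normE.
Unshelve. all: by end_near. Qed.

End unif_lim.

(* [Cb K Y]: bounded continuous functions K -> Y, as a Banach space for [supnorm]
   (see [Cb_normE]) and a metric space for the induced distance [Cb_mdistE]. *)
Section Cb.
Context {R : realType} (K : topologicalType) (Y : normedModType R).

Definition bcont : {pred K -> Y} :=
  mem [set f : K -> Y | bounded_fun f /\ continuous f].

Lemma bcontP (f : K -> Y) : f \in bcont <-> bounded_fun f /\ continuous f.
Proof. by rewrite inE. Qed.

Lemma bcont_submod : submod_closed bcont.
Proof.
split=> [|a f g /bcontP[bf cf] /bcontP[bg cg]]; apply/bcontP; split.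
- by apply/bounded_fun_leP; exists 0 => x; rewrite normr0.
- exact: cst_continuous.
- by apply: bounded_fun_add => //; exact: bounded_funZ.
- by move=> x; apply: cvgD; [apply: cvgZr; exact: cf|exact: cg].
Qed.

HB.instance Definition _ := GRing.isSubmodClosed.Build R (K -> Y) bcont
  bcont_submod.

Record Cb := MkCb { Cb_fun :> K -> Y; Cb_funP : Cb_fun \in bcont }.

HB.instance Definition _ := [isSub of Cb for Cb_fun].
HB.instance Definition _ := [Choice of Cb by <:].
HB.instance Definition _ := [SubChoice_isSubLmodule of Cb by <:].

Let nm (f : Cb) : R := supnorm f.

Lemma Cb_bounded (f : Cb) : bounded_fun f.
Proof. by have /bcontP[] := Cb_funP f. Qed.

Lemma Cb_continuous (f : Cb) : continuous f.
Proof. by have /bcontP[] := Cb_funP f. Qed.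

Let ler_nmD (f g : Cb) : nm (f + g) <= nm f + nm g.
Proof. by apply: ler_supnormD; exact: Cb_bounded. Qed.

Let nmZ (a : R) (f : Cb) : nm (a *: f) = `|a| * nm f.
Proof. by apply: supnormZ; exact: Cb_bounded. Qed.

Let nm0_eq0 (f : Cb) : nm f = 0 -> f = 0.
Proof. by move=> f0; apply/val_inj/supnorm0_eq0 => //; exact: Cb_bounded. Qed.

HB.instance Definition _ := Lmodule_isNormed.Build R Cb ler_nmD nmZ nm0_eq0.

Let dist (f g : Cb) : R := `|g - f|.

Let dist_ge0 (f g : Cb) : 0 <= dist f g.
Proof. exact: normr_ge0. Qed.

Let dist_positivity (f g : Cb) : dist f g = 0 -> f = g.
Proof. by move/normr0_eq0/eqP; rewrite subr_eq0 => /eqP. Qed.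

Let ballEdist (f : Cb) (r : R) : ball f r = [set g | dist f g < r].
Proof.
by rewrite -ball_normE; apply/seteqP; split => g; rewrite /= /dist distrC.
Qed.

HB.instance Definition _ := PseudoMetric_isMetric.Build R Cb
  dist_ge0 dist_positivity ballEdist.

Lemma Cb_normE (f : Cb) : `|f| = supnorm f. Proof. by []. Qed.

Lemma Cb_mdistE (f g : Cb) : mdist f g = `|g - f|. Proof. by []. Qed.

End Cb.
Arguments bcont {R K Y}.

Section Cb_complete.
Context {R : realType} (K : topologicalType) (Y : completeNormedModType R).

Let Cb_cauchy_cvg (F : set_system (Cb K Y)) : ProperFilter F -> cauchy F ->
  cvg F.
Proof.
move=> FF cF.
have ev_le (f g : Cb K Y) x : `|f x - g x| <= `|f - g|.
  exact: (supnorm_ub x (Cb_bounded (f - g))).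
have [g gF] := cauchy_unif_lim ev_le FF cF.
have gP : g \in bcont.
  apply/bcontP; split.
    apply: unif_approx_bounded => e /gF gFe; near F => f.
    by exists f; [exact: Cb_bounded|near: f].
  move=> x; apply/cvgrPdist_le => e e0.
  have e30 : 0 < e / 3 by rewrite divr_gt0.
  have := gF _ e30; near F => f.
  have {}gf y : `|g y - f y| <= e / 3 by move: y; near: f; exact: gF.
  move=> _; near=> y.
  have -> : g x - g y = (g x - f x) + (f x - f y) + (f y - g y).
    by rewrite !addrA !subrK.
  rewrite (le_trans (ler_normD _ _))//.
  have -> : e = e / 3 + e / 3 + e / 3 by field.
  rewrite lerD//; last by rewrite distrC.
  rewrite (le_trans (ler_normD _ _))// lerD//.
  by near: y; have /cvgrPdist_le := @Cb_continuous _ _ _ f x; exact.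
apply/cvg_ex; exists (MkCb gP); apply/fcvgrPdist_lt => e e0.
have e20 : 0 < e / 2 by rewrite divr_gt0.
apply: filterS (gF _ e20) => f gf.
rewrite (@le_lt_trans _ _ (e / 2)) ?gtr_pMr ?invf_lt1 ?ltr1n//.
by apply: supnorm_le => //; exact: ltW.
Unshelve. all: by end_near. Qed.

HB.instance Definition _ := Uniform_isComplete.Build (Cb K Y) Cb_cauchy_cvg.

End Cb_complete.

Section unif_continuous.
Context {R : realType} {K : uniformType} {Y : normedModType R}.
Implicit Types f g : K -> Y.

Lemma unif_continuousP f : unif_continuous f <->
  forall e : R, 0 < e -> entourage [set xy | `|f xy.1 - f xy.2| < e].
Proof.
split=> [cf e e0|cf A].
  have := cf _ (entourage_ball Y (PosNum e0)).
  by rewrite /nbhs /= -ball_normE.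
rewrite -entourage_ballE => -[e /= e0 eA].
apply: filterS (cf e e0) => xy /= xye; apply: eA.
by rewrite /= -ball_normE.
Qed.

Lemma unif_continuousD f g :
  unif_continuous f -> unif_continuous g -> unif_continuous (f + g).
Proof.
move=> /unif_continuousP cf /unif_continuousP cg.
apply/unif_continuousP => e e0; have e20 : 0 < e / 2 by rewrite divr_gt0.
apply: filterS2 (cf _ e20) (cg _ e20) => xy /= fe ge.
have -> : (f + g) xy.1 - (f + g) xy.2 =
  (f xy.1 - f xy.2) + (g xy.1 - g xy.2) by rewrite opprD addrACA.
by rewrite (le_lt_trans (ler_normD _ _))// [e]splitr ltrD.
Qed.

Lemma unif_continuousZ (a : R) f :
  unif_continuous f -> unif_continuous (a *: f).
Proof.
move=> /unif_continuousP cf; apply/unif_continuousP => e e0.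
have a0 : 0 < `|a| + 1 by rewrite ltr_wpDl.
apply: filterS (cf (e / (`|a| + 1)) _) => [xy /= fe|]; last by rewrite divr_gt0.
rewrite -scalerBr normrZ; move: fe; rewrite ltr_pdivlMr// mulrC.
by apply: le_lt_trans; rewrite ler_wpM2r// lerDl.
Qed.

End unif_continuous.

(* [Cbu K Y]: likewise for the bounded uniformly continuous functions. *)
Section Cbu.
Context {R : realType} (K : uniformType) (Y : normedModType R).

Definition bucont : {pred K -> Y} :=
  mem [set f : K -> Y | bounded_fun f /\ unif_continuous f].

Lemma bucontP (f : K -> Y) :
  f \in bucont <-> bounded_fun f /\ unif_continuous f.
Proof. by rewrite inE. Qed.

Lemma bucont_submod : submod_closed bucont.
Proof.
split=> [|a f g /bucontP[bf cf] /bucontP[bg cg]]; apply/bucontP; split.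
- by apply/bounded_fun_leP; exists 0 => x; rewrite normr0.
- apply/unif_continuousP => e e0; apply: filterS filterT => xy _ /=.
  by rewrite subrr normr0.
- by apply: bounded_fun_add => //; exact: bounded_funZ.
- by apply: unif_continuousD => //; exact: unif_continuousZ.
Qed.

HB.instance Definition _ := GRing.isSubmodClosed.Build R (K -> Y) bucont
  bucont_submod.

Record Cbu := MkCbu { Cbu_fun :> K -> Y; Cbu_funP : Cbu_fun \in bucont }.

HB.instance Definition _ := [isSub of Cbu for Cbu_fun].
HB.instance Definition _ := [Choice of Cbu by <:].
HB.instance Definition _ := [SubChoice_isSubLmodule of Cbu by <:].

Let nm (f : Cbu) : R := supnorm f.

Lemma Cbu_bounded (f : Cbu) : bounded_fun f.
Proof. by have /bucontP[] := Cbu_funP f. Qed.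

Lemma Cbu_unif_continuous (f : Cbu) : unif_continuous f.
Proof. by have /bucontP[] := Cbu_funP f. Qed.

Let ler_nmD (f g : Cbu) : nm (f + g) <= nm f + nm g.
Proof. by apply: ler_supnormD; exact: Cbu_bounded. Qed.

Let nmZ (a : R) (f : Cbu) : nm (a *: f) = `|a| * nm f.
Proof. by apply: supnormZ; exact: Cbu_bounded. Qed.

Let nm0_eq0 (f : Cbu) : nm f = 0 -> f = 0.
Proof. by move=> f0; apply/val_inj/supnorm0_eq0 => //; exact: Cbu_bounded. Qed.

HB.instance Definition _ := Lmodule_isNormed.Build R Cbu ler_nmD nmZ nm0_eq0.

Let dist (f g : Cbu) : R := `|g - f|.

Let dist_ge0 (f g : Cbu) : 0 <= dist f g.
Proof. exact: normr_ge0. Qed.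

Let dist_positivity (f g : Cbu) : dist f g = 0 -> f = g.
Proof. by move/normr0_eq0/eqP; rewrite subr_eq0 => /eqP. Qed.

Let ballEdist (f : Cbu) (r : R) : ball f r = [set g | dist f g < r].
Proof.
by rewrite -ball_normE; apply/seteqP; split => g; rewrite /= /dist distrC.
Qed.

HB.instance Definition _ := PseudoMetric_isMetric.Build R Cbu
  dist_ge0 dist_positivity ballEdist.

Lemma Cbu_normE (f : Cbu) : `|f| = supnorm f. Proof. by []. Qed.

Lemma Cbu_mdistE (f g : Cbu) : mdist f g = `|g - f|. Proof. by []. Qed.

End Cbu.
Arguments bucont {R K Y}.

Section Cbu_complete.
Context {R : realType} (K : uniformType) (Y : completeNormedModType R).

Let Cbu_cauchy_cvg (F : set_system (Cbu K Y)) : ProperFilter F -> cauchy F ->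
  cvg F.
Proof.
move=> FF cF.
have ev_le (f g : Cbu K Y) x : `|f x - g x| <= `|f - g|.
  exact: (supnorm_ub x (Cbu_bounded (f - g))).
have [g gF] := cauchy_unif_lim ev_le FF cF.
have gP : g \in bucont.
  apply/bucontP; split.
    apply: unif_approx_bounded => e /gF gFe; near F => f.
    by exists f; [exact: Cbu_bounded|near: f].
  apply/unif_continuousP => e e0.
  have e30 : 0 < e / 3 by rewrite divr_gt0.
  near F => f.
  have gf y : `|g y - f y| <= e / 3 by move: y; near: f; exact: gF.
  have /unif_continuousP/(_ _ e30) := @Cbu_unif_continuous _ _ _ f.
  apply: filterS => -[x y] /= fxy.
  have -> : g x - g y = (g x - f x) + (f y - g y) + (f x - f y).
    by rewrite addrAC !addrA !subrK.
  rewrite (le_lt_trans (ler_normD _ _))//.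
  have -> : e = e / 3 + e / 3 + e / 3 by field.
  rewrite ler_ltD// (le_trans (ler_normD _ _))// lerD//.
  by rewrite distrC.
apply/cvg_ex; exists (MkCbu gP); apply/fcvgrPdist_lt => e e0.
have e20 : 0 < e / 2 by rewrite divr_gt0.
apply: filterS (gF _ e20) => f gf.
rewrite (@le_lt_trans _ _ (e / 2)) ?gtr_pMr ?invf_lt1 ?ltr1n//.
by apply: supnorm_le => //; exact: ltW.
Unshelve. all: by end_near. Qed.

HB.instance Definition _ := Uniform_isComplete.Build (Cbu K Y) Cbu_cauchy_cvg.

End Cbu_complete.

Definition attains_strongly {R : realType} {K : metricType R}
    {Y : normedModType R} (T : K -> Y) : Prop :=
  exists x0 : K, `|T x0| = supnorm T /\
    forall x_ : nat -> K,
      `|T (x_ n)| @[n --> \oo] --> supnorm T ->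
      mdist (x_ n) x0 @[n --> \oo] --> (0 : R).

(* Main.v *)
Require Import Defs.
From mathcomp Require Import all_boot all_order all_algebra.
From mathcomp Require Import all_classical all_reals all_analysis.
From mathcomp Require Import lra.

Import Order.TTheory GRing.Theory Num.Theory.
Import numFieldNormedType.Exports.

Local Open Scope classical_set_scope.
Local Open Scope ring_scope.

(** Call T peaked at scale e if some superlevel set {x | c < |T x|}, with c
    below the sup-norm of T, lies in a ball of radius e.  The proof has two
    halves.

    A bounded continuous T on a complete K attains its sup-norm strongly if and
    only if it is peaked at every scale ([attains_stronglyP]).  If it is, the
    superlevel sets are the basis of a Cauchy filter, whose limit x0 satisfies
    |T x0| = supnorm T by continuity, and any maximizing sequence runs through
    this filter.

    For a fixed scale e, the functions that are not peaked at scale e form a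
    porous set ([porous_not_peaked]).  Given T and r, choose x0 where |T x0|
    nearly equals supnorm T, and add to T a bump of height r / 2 and radius e
    around x0, in the direction of T x0.  The norm at x0 then exceeds the old
    supremum by almost r / 2, while it is unchanged away from x0, so the new
    function is peaked at scale e with a margin proportional to r, and so is
    every function within r / 8 of it.

    Taking the scales 1 / (n + 1) writes the functions that do not attain
    strongly as a countable union of porous sets.  The bump is Lipschitz, hence
    uniformly continuous, so the same argument serves both function spaces. *)

(** * Strong attainment and superlevel sets *)

Definition peaked {R : realType} {K : metricType R} {Y : normedModType R}
    (e : R) (T : K -> Y) : Prop :=
  exists c x0, c < supnorm T /\ forall x, c < `|T x| -> mdist x0 x < e.

Lemma supnorm_gt {R : realType} {K : Type} {Y : normedModType R} (T : K -> Y)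
    (k : K) (c : R) : c < supnorm T -> exists x, c < `|T x|.
Proof. by move=> /sup_gt[|_ [x _ <-] cx]; [exists `|T k|, k|exists x]. Qed.

(** Otherwise the superlevel sets for supnorm T - 1 / (n + 1) would all leave the
    ball of radius e around the maximum point, giving a maximizing sequence that
    stays at distance e from it. *)
Lemma attains_strongly_peaked {R : realType} {K : metricType R}
    {Y : normedModType R} (T : K -> Y) (e : R) :
  bounded_fun T -> 0 < e -> attains_strongly T -> peaked e T.
Proof.
move=> bT e0 [x0 [Tx0 strong]]; apply: contrapT => npk.
have far n : exists x, supnorm T - n.+1%:R^-1 < `|T x| /\ e <= mdist x0 x.
  apply: contrapT => nfar; apply: npk; exists (supnorm T - n.+1%:R^-1), x0.
  split=> [|x cx]; first by rewrite ltrBlDr ltrDl invr_gt0.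
  by rewrite ltNge; apply/negP => ex; apply: nfar; exists x.
have [x_ x_P] := choice far.
have cvT : `|T (x_ n)| @[n --> \oo] --> supnorm T.
  apply: (@squeeze_cvgr _ _ _ _ (fun n => supnorm T - n.+1%:R^-1)
    (fun=> supnorm T)).
  - by near=> n; have [/ltW -> _] := x_P n; rewrite supnorm_ub.
  - by rewrite -[X in _ --> X]subr0; apply: cvgB; [exact: cvg_cst|
      exact: cvg_harmonic].
  - exact: cvg_cst.
have /cvgr0_norm_lt/(_ _ e0)[N _ /(_ N (leqnn N))] := strong _ cvT.
rewrite ger0_norm ?mdist_ge0// metric_sym => /lt_le_trans.
by move=> /(_ _ (x_P N).2); rewrite ltxx.
Unshelve. all: by end_near. Qed.

Lemma peaked_attains_strongly {R : realType} {K : completeMetricType R}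
    {Y : normedModType R} (T : K -> Y) :
  bounded_fun T -> continuous T -> (forall n : nat, peaked n.+1%:R^-1 T) ->
  attains_strongly T.
Proof.
move=> bT cT pk.
pose F : set_system K := filter_from [set c | c < supnorm T]
  (fun c => [set x | c < `|T x|]).
have FF : Filter F.
  apply: filter_from_filter => [|c d /= cT' dT'].
    by have [c [? []]] := pk 0%N; exists c.
  exists (Num.max c d); first by rewrite /= gt_max cT' dT'.
  by move=> x /=; rewrite gt_max => /andP[].
have PF : ProperFilter F.
  by apply: filter_from_proper => c /(supnorm_gt T point).
have : cvg F.
  apply/cauchy_cvgP/cauchy_exP => e e0.
  have [n _ /(_ n (leqnn n))/= ne] := near_infty_natSinv_lt (PosNum e0).
  have [c [x0 [cT' cx0]]] := pk n; exists x0, c => //= x /cx0 x0x.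
  by rewrite ballEmdist/= (lt_trans x0x).
move=> /cvg_ex[x0 Fx0]; exists x0; split.
  have TF : `|T x| @[x --> F] --> supnorm T.
    apply/cvgrPdist_lt => e e0; exists (supnorm T - e) => /=.
      by rewrite ltrBlDr ltrDl.
    move=> x /= ex; rewrite ger0_norm ?subr_ge0 ?supnorm_ub//.
    by rewrite ltrBlDr -ltrBlDl.
  have TF' : `|T x| @[x --> F] --> `|T x0|.
    by apply: cvg_norm; apply: cvg_trans (cT x0); exact: cvg_app.
  exact: (cvg_unique (@norm_hausdorff _ R^o) TF' TF).
move=> x_ x_T.
have x_F : x_ @ \oo --> F.
  move=> A [c /= cT' cA].
  by apply: filterS (cvgr_gt _ x_T _ cT') => n; exact: cA.
apply/cvgr0Pnorm_lt => e e0.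
have xe : \forall n \near \oo, ball x0 e (x_ n).
  exact: cvg_trans x_F Fx0 _ (nbhsx_ballx x0 e e0).
apply: filterS xe => n; rewrite /= ballEmdist/= ger0_norm ?mdist_ge0//.
by rewrite metric_sym.
Qed.

Lemma attains_stronglyP {R : realType} {K : completeMetricType R}
    {Y : normedModType R} (T : K -> Y) :
  bounded_fun T -> continuous T ->
  attains_strongly T <-> forall n : nat, peaked n.+1%:R^-1 T.
Proof.
move=> bT cT; split=> [sT n|]; last exact: peaked_attains_strongly.
by apply: attains_strongly_peaked => //; rewrite invr_gt0.
Qed.

(** * Perturbation by a bump *)

Definition bump {R : realType} {K : metricType R} (e : R) (x0 x : K) : R :=
  Num.max 0 (1 - mdist x0 x / e).

Section bump.
Context {R : realType} {K : metricType R} {e : R} {x0 : K}.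
Hypothesis e0 : 0 < e.

Lemma bump_ge0 x : 0 <= bump e x0 x.
Proof. by rewrite le_max lexx. Qed.

Lemma bump_le1 x : bump e x0 x <= 1.
Proof.
by rewrite ge_max ler01/= lerBlDr lerDl divr_ge0 ?mdist_ge0// ltW.
Qed.

Lemma bump_center : bump e x0 x0 = 1.
Proof. by rewrite /bump mdistxx mul0r subr0; apply/max_idPr. Qed.

Lemma bump_out x : e <= mdist x0 x -> bump e x0 x = 0.
Proof.
by move=> ex; apply/max_idPl; rewrite subr_le0 ler_pdivlMr// mul1r.
Qed.

Lemma bump_lipschitz x y : `|bump e x0 x - bump e x0 y| <= mdist x y / e.
Proof.
have : `|mdist x0 x - mdist x0 y| / e <= mdist x y / e.
  rewrite ler_pM2r ?invr_gt0// ler_norml; apply/andP; split.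
    rewrite lerBrDr addrC lerBlDr; exact: metric_triangle.
  by rewrite lerBlDl [X in _ + X]metric_sym; exact: metric_triangle.
apply: le_trans.
rewrite -[in leRHS](@ger0_norm _ e^-1) ?invr_ge0 ?(ltW e0)// -normrM mulrBl.
rewrite /bump; set a := mdist _ _ / e; set b := mdist _ _ / e.
by case: (leP 0 (1 - a)) => ?; case: (leP 0 (1 - b)) => ?;
  case: (ger0P (a - b)) => ?; rewrite ler_norml; apply/andP; split; lra.
Qed.

Context {Y : normedModType R} (v : Y).

Lemma bounded_bump : bounded_fun (fun x => bump e x0 x *: v).
Proof.
apply/bounded_fun_leP; exists `|v| => x.
by rewrite normrZ ger0_norm ?bump_ge0// ler_piMl// bump_le1.
Qed.

Lemma unif_continuous_bump : unif_continuous (fun x => bump e x0 x *: v).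
Proof.
apply/unif_continuousP => d d0 /=.
have v0 : 0 < `|v| + 1 by rewrite ltr_wpDl.
exists (d / (`|v| + 1) * e); first by rewrite mulr_gt0// divr_gt0.
move=> [x y] /=; rewrite ballEmdist -ball_normE/= -scalerBl normrZ.
rewrite -ltr_pdivrMr// ltr_pdivlMr// => xy; apply: le_lt_trans xy.
by rewrite ler_pM ?bump_lipschitz// lerDl.
Qed.

End bump.

Lemma unif_continuous_continuous {U V : uniformType} (f : U -> V) :
  unif_continuous f -> continuous f.
Proof.
move=> cf x A /nbhsP[E entE EA].
by apply/nbhsP; exists [set xy | E (f xy.1, f xy.2)];
  [exact: cf|move=> y /xsectionP Ey; apply: EA; exact/xsectionP].
Qed.

Lemma exists_aligned_unit {R : realType} {Y : normedModType R} (w : Y) :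
  (exists y : Y, y != 0) ->
  exists2 u : Y, `|u| = 1 & forall t, 0 <= t -> `|w + t *: u| = `|w| + t.
Proof.
have unit (y : Y) : y != 0 -> `|(`|y|^-1 *: y)| = 1.
  by move=> y0; rewrite normrZ normfV normr_id mulVf ?normr_eq0.
move=> [y y0]; have [->|w0] := eqVneq w 0.
  exists (`|y|^-1 *: y); first exact: unit.
  by move=> t t0; rewrite add0r normrZ unit// mulr1 normr0 add0r ger0_norm.
exists (`|w|^-1 *: w); first exact: unit.
move=> t t0; rewrite scalerA -{1}(scale1r w) -scalerDl normrZ.
rewrite ger0_norm ?addr_ge0 ?divr_ge0//.
by rewrite mulrDl mul1r mulfVK// normr_eq0.
Qed.

(** The level c := supnorm T + r / 8 separates the two regimes: at x0 a function S
    as in the conclusion has norm above supnorm T - r / 8 + r / 2 - r / 8, whereas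
    off the ball of radius e it has norm at most supnorm T + r / 8. *)
Lemma peaked_near_bump {R : realType} {K : metricType R} {Y : normedModType R}
    (T : K -> Y) (k : K) (e r : R) :
  (exists y : Y, y != 0) -> bounded_fun T -> 0 < e -> 0 < r ->
  exists x0 (v : Y), `|v| = r / 2 /\
    forall S : K -> Y, bounded_fun S ->
      (forall x, `|S x - (T x + bump e x0 x *: v)| <= r / 8) -> peaked e S.
Proof.
move=> Y0 bT e0 r0.
have [x0 Tx0] : exists x0, supnorm T - r / 8 < `|T x0|.
  by apply: (supnorm_gt T k); rewrite ltrBlDr ltrDl divr_gt0.
have [u u1 uT] := exists_aligned_unit (T x0) Y0.
have r20 : 0 <= r / 2 by rewrite divr_ge0// ltW.
exists x0, ((r / 2) *: u); split; first by rewrite normrZ u1 mulr1 ger0_norm.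
move=> S bS ST; exists (supnorm T + r / 8), x0; split=> [|x].
  apply: lt_le_trans (supnorm_ub x0 bS).
  have := lerB_dist (T x0 + (r / 2) *: u) (S x0).
  have := ST x0; rewrite bump_center scale1r distrC uT//; lra.
rewrite !ltNge; apply: contra => /(bump_out e0) bx.
have := ST x; rewrite bx scale0r addr0 => STx.
have := ler_normD (S x - T x) (T x); rewrite subrK.
have := supnorm_ub x bT; lra.
Qed.

(** * Porosity *)

(** Both function spaces are treated at once: M is a space of bounded functions
    under the evaluation map ev, with the sup-distance, stable under the addition
    of bumps. *)
Section porosity.
Context {R : realType} {K : completeMetricType R} {Y : normedModType R}.
Context {M : metricType R} (ev : M -> K -> Y).
Hypothesis Y0 : exists y : Y, y != 0.
Hypothesis ev_bounded : forall T, bounded_fun (ev T).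
Hypothesis ev_continuous : forall T, continuous (ev T).
Hypothesis ev_mdist : forall S T, mdist S T = supnorm (ev T - ev S).
Hypothesis ev_bump : forall T e x0 v, 0 < e ->
  exists T', ev T' = ev T + (fun x => bump e x0 x *: v).

Lemma porous_not_peaked (e : R) : 0 < e ->
  porous [set T : M | ~ peaked e (ev T)].
Proof.
move=> e0; exists 8^-1, 1; split=> [||//|T r r0 _].
- by rewrite invr_gt0.
- by rewrite invf_le1 ?ler1n.
have [x0 [v [vr near]]] := @peaked_near_bump _ _ _ (ev T) point _ _ Y0
  (ev_bounded T) e0 r0.
have [T' T'E] := ev_bump T e x0 v e0; exists T'.
have TT' : mdist T T' <= r / 2.
  rewrite ev_mdist T'E addrAC subrr add0r; apply: supnorm_le => [|x].
    by rewrite divr_ge0// ltW.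
  by rewrite normrZ ger0_norm ?bump_ge0// vr ler_piMl ?bump_le1 ?divr_ge0// ltW.
move=> S; rewrite !ballEmdist/= => T'S; split.
  by apply: le_lt_trans (metric_triangle T T' S) _; lra.
apply; apply: near => // x.
have -> : ev T x + bump e x0 x *: v = ev T' x by rewrite T'E.
have bd : bounded_fun (ev S - ev T').
  by rewrite -scaleN1r; apply: bounded_fun_add => //; exact: bounded_funZ.
have := supnorm_ub x bd; rewrite -ev_mdist; lra.
Qed.

Lemma attains_strongly_compl_sigma_porous : exists A : set M,
  sigma_porous A /\ [set T : M | attains_strongly (ev T)] = ~` A.
Proof.
exists (\bigcup_n [set T : M | ~ peaked n.+1%:R^-1 (ev T)]); split.
  exists (fun n => [set T : M | ~ peaked n.+1%:R^-1 (ev T)]) => // n.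
  by apply: porous_not_peaked; rewrite invr_gt0.
apply/seteqP; split=> T /=.
  by move=> /attains_stronglyP pk [n _ /=]; apply; exact: pk.
move=> npk; apply/attains_stronglyP => // n.
by apply: contrapT => nT; apply: npk; exists n.
Qed.

End porosity.

Theorem corollary6 (R : realType) (K : completeMetricType R)
    (Y : completeNormedModType R) (Y_nonzero : exists y : Y, y != 0) :
  (exists A : set (Cb K Y),
     sigma_porous A /\ [set T : Cb K Y | attains_strongly T] = ~` A) /\
  (exists A : set (Cbu K Y),
     sigma_porous A /\ [set T : Cbu K Y | attains_strongly T] = ~` A).
Proof.
split.
  apply: (@attains_strongly_compl_sigma_porous _ _ _ _ (@Cb_fun R K Y)) => //.
  - exact: Cb_bounded.
  - exact: Cb_continuous.
  - move=> T e x0 v e0.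
    have bP : (fun x => bump e x0 x *: v) \in @bcont R K Y.
      apply/bcontP; split; first exact: bounded_bump.
      exact: unif_continuous_continuous (unif_continuous_bump e0 v).
    by exists (T + MkCb bP).
apply: (@attains_strongly_compl_sigma_porous _ _ _ _ (@Cbu_fun R K Y)) => //.
- exact: Cbu_bounded.
- move=> T; exact: unif_continuous_continuous (@Cbu_unif_continuous _ _ _ T).
- move=> T e x0 v e0.
  have bP : (fun x => bump e x0 x *: v) \in @bucont R K Y.
    by apply/bucontP; split; [exact: bounded_bump|exact: unif_continuous_bump].
  by exists (T + MkCbu bP).
Qed.
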